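(* Let $\mathcal{A}$ be a unital Banach algebra with a one-parameter automorphism group $\Psi$, let $1\le p\le\infty$ and $r>0$. Then the Besov algebra $\Lambda^p_r(\mathcal{A})$ admits the following norm control in $\mathcal{A}$: there is a constant $C>0$ depending on $r$ and $p$ (for the given $\mathcal{A}$ and $\Psi$, and independent of $a$) such that for every $a\in\Lambda^p_r(\mathcal{A})$ that is invertible in $\mathcal{A}$ we have $a^{-1}\in\Lambda^p_r(\mathcal{A})$ and $$|a^{-1}|_{\Lambda^p_r(\mathcal{A})}\le C\,\|a^{-1}\|_{\mathcal{A}}^2\,\|a\|_{\Lambda^p_r(\mathcal{A})}\,\frac{\|a^{-1}\|_{\mathcal{A}}^{\lfloor r\rfloor+1}\,\|a\|_{\Lambda^p_r(\mathcal{A})}^{\lfloor r\rfloor+1}-1}{\|a^{-1}\|_{\mathcal{A}}\,\|a\|_{\Lambda^p_r(\mathcal{A})}-1},$$ where the quotient is read as $\lfloor r\rfloor+1$ if its denominator is zero. In particular, there is such a constant $C$ with the property that if $\|a\|_{\Lambda^p_r(\mathcal{A})}\le1$ and $\|a^{-1}\|_{\mathcal{A}}\le1/\delta$, then $$\|a^{-1}\|_{\Lambda^p_r(\mathcal{A})}\le C\,\delta^{-\lfloor r\rfloor-2}.$$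
   Context: A (one-parameter) automorphism group on $\mathcal{A}$ is a family $\Psi=\{\psi_t\}_{t\in\mathbb{R}}$ of Banach algebra automorphisms of $\mathcal{A}$ with $\psi_s\psi_t=\psi_{s+t}$ for all $s,t\in\mathbb{R}$ and $M_\Psi=\sup_{t\in\mathbb{R}}\|\psi_t\|_{\mathcal{A}\to\mathcal{A}}<\infty$ (if $\mathcal{A}$ is a $*$-algebra, the $\psi_t$ are $*$-automorphisms). Difference operators: $\Delta_ta=\psi_t(a)-a$ and $\Delta_t^k=(\psi_t-\mathrm{id})^k$. For $1\le p<\infty$, $r>0$ and $k=\lfloor r\rfloor+1$ (the smallest integer strictly greater than $r$), the Besov space $\Lambda^p_r(\mathcal{A})$ consists of all $a\in\mathcal{A}$ for which $$\|a\|_{\Lambda^p_r(\mathcal{A})}=\|a\|_{\mathcal{A}}+|a|_{\Lambda^p_r(\mathcal{A})},\qquad|a|_{\Lambda^p_r(\mathcal{A})}=\Big(\int_{\mathbb{R}}\big(|t|^{-r}\|\Delta^k_ta\|_{\mathcal{A}}\big)^p\,\frac{dt}{|t|}\Big)^{1/p}$$ is finite; for $p=\infty$ the integral is replaced by $\sup_{t\ne0}|t|^{-r}\|\Delta_t^ka\|_{\mathcal{A}}$. *)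

(* Defs.v *)
From HB Require Import structures.
From mathcomp Require Import all_boot all_order all_algebra.
From mathcomp Require Import complex.
From mathcomp Require Import all_classical all_reals all_analysis.

Set Implicit Arguments.
Unset Strict Implicit.
Unset Printing Implicit Defensive.
Import Order.TTheory GRing.Theory Num.Theory.
Import numFieldNormedType.Exports.
Local Open Scope classical_set_scope.
Local Open Scope ring_scope.

Variant scalar_kind := RealScalars | ComplexScalars.

Definition scalar (R : realType) (s : scalar_kind) : numFieldType :=
  match s with RealScalars => R | ComplexScalars => R[i] end.

(* The library absolute value on R[i] has values in R[i]; this is the same
   absolute value with values in R. *)
Definition scalar_abs (R : realType) (s : scalar_kind) : scalar R s -> R :=
  match s with
  | RealScalars => fun x => `|x|
  | ComplexScalars => fun x => complex.Re `|x|
  end.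

(* The library's normed modules cannot be joined with its rings in one
   structure ([numDomainType] already inherits from both), so the norm, real
   valued for both kinds of scalars, and its completeness are added to the
   algebra here.
   Invertibility and inverses are those of [unitRingType], whose units are
   exactly the two-sided invertible elements.  The norm of 1 need not be 1. *)
HB.mixin Record isBanach (R : realType) (s : scalar_kind) A
    of GRing.UnitAlgebra (scalar R s) A := {
  anorm : A -> R;
  anorm0_eq0 : forall a, anorm a = 0 -> a = 0;
  anormD_le : forall a b, anorm (a + b) <= anorm a + anorm b;
  anormZ : forall (c : scalar R s) a, anorm (c *: a) = scalar_abs c * anorm a;
  anormM_le : forall a b, anorm (a * b) <= anorm a * anorm b;
  anorm_complete : forall u : nat -> A,
    (forall e : R, 0 < e ->
       exists N, forall m n, (N <= m)%N -> (N <= n)%N -> anorm (u m - u n) < e) ->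
    exists l : A, (fun n => anorm (u n - l)) @ \oo --> (0 : R)
}.

#[short(type="banachAlgType")]
HB.structure Definition BanachAlgebra (R : realType) (s : scalar_kind) :=
  {A of GRing.UnitAlgebra (scalar R s) A & isBanach R s A}.

(* [aut_bounded] says that the supremum over t of the operator norms of the
   [aut t] is finite. *)
Record automorphism_group (R : realType) (s : scalar_kind)
    (A : banachAlgType R s) := AutomorphismGroup {
  aut :> R -> {lrmorphism A -> A};
  aut_bij : forall t, bijective (aut t);
  autD : forall t u a, aut t (aut u a) = aut (t + u) a;
  aut_bounded : exists M : R, forall t a, anorm (aut t a) <= M * anorm a
}.

Section Besov.
Context (R : realType) (s : scalar_kind) (A : banachAlgType R s).
Variable Psi : automorphism_group A.

Definition difference (t : R) (a : A) : A := Psi t a - a.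

Definition besov_order (r : R) : nat := (Num.truncn r).+1.

Definition besov_quotient (r : R) (a : A) (t : R) : R :=
  `|t| `^ (- r) * anorm (iter (besov_order r) (difference t) a).

Definition besov_seminorm (p : \bar R) (r : R) (a : A) : \bar R :=
  match p with
  | q%:E => poweR (\int[lebesgue_measure]_(t in [set: R])
                     (besov_quotient r a t `^ q / `|t|)%:E)%E q^-1
  | +oo%E => ereal_sup [set (besov_quotient r a t)%:E | t in [set t | t != 0]]
  | -oo%E => 0%E
  end.

Definition besov_norm (p : \bar R) (r : R) (a : A) : \bar R :=
  ((anorm a)%:E + besov_seminorm p r a)%E.

(* No continuity of t |-> Psi t a is assumed, so finiteness of the integral has
   to include measurability of the integrand: the library integral of a
   non-measurable nonnegative function is a lower integral. *)
Definition besov (p : \bar R) (r : R) : set A :=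
  [set a | (p != +oo%E -> measurable_fun [set: R] (besov_quotient r a))
           /\ (besov_norm p r a < +oo)%E].

End Besov.

(* Main.v *)
Require Import Defs.
From HB Require Import structures.
From mathcomp Require Import all_boot all_order all_algebra.
From mathcomp Require Import all_classical all_reals all_analysis.
From mathcomp Require Import complex measurable_realfun ring lra.
Import Order.TTheory GRing.Theory Num.Theory.
Import numFieldNormedType.Exports.
Local Open Scope classical_set_scope.
Local Open Scope ring_scope.

(** Write [T] for one of the automorphisms, [D = T - id], and set
    [d_j = |D^j a|], [e_j = |D^j b|], where [b] is the inverse of [a].  The norm
    control holds separately for each [t], before any integral or supremum over
    [t] is taken: for [k >= 1],
<<
      e_k <= C |b|^2 d_k (1 + |b||a| + ... + (|b||a|)^(k-1)),
>>
    with [C] depending only on [k] and on a bound [M] for all powers of [T]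
    ([reciprocal_difference_le]).

    Two facts give this.  Expanding [0 = D^k (a b)] by the Leibniz rule
    ([leibniz_iter_opdiff]) and multiplying by [b] bounds [e_k] by [|b|] times a
    combination of the products [d_j e_(k-j)], [1 <= j <= k]; by induction these
    are controlled by the products [d_j d_(k-j)].  The latter are reduced to
    [|a| d_k] by the interpolation inequality [d_i d_j <= C |a| d_(i+j)]
    ([diff_mul_diff_le]), a consequence of the discrete Landau-Kolmogorov
    inequality [d_1^2 <= C |a| d_2] ([landau_kolmogorov]) for power bounded
    operators.  Multiplying by [|t|^(-r)] and taking Besov seminorms gives the
    first estimate.  The second follows because [1 <= |1| <= |a||b|] forces
    [delta <= 1].

    For finite [p] membership in the Besov space also requires the quotient of
    [b] to be measurable, although the orbits [t |-> psi_t a] are not supposed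
    continuous.  They are continuous when [a] has finite seminorm
    ([besov_orbit_continuous]).  By Markov's inequality the Besov quotient of [a]
    is bounded by a fixed [L] on more than three quarters of [(0, 2h)], so that
    [h] is a difference of two times at which it is ([shifted_pair_bounded]);
    interpolation turns this into
    [|psi_h a - a|^k <= C h^r] with [k = truncn r + 1].  Inversion preserves
    continuity of the orbit, and a continuous orbit has a measurable Besov
    quotient. *)

(** * The norm of a Banach algebra *)

Lemma ler_of_eq {R : realType} (x y : R) : x = y -> x <= y.
Proof. by move=> ->. Qed.

Section AlgebraNorm.
Context {R : realType} {s : scalar_kind} {A : banachAlgType R s}.
Implicit Types (a b x y : A) (n : nat).

Lemma scalar_absN1 : scalar_abs (-1 : Defs.scalar R s) = 1.
Proof.
case: s; first exact: normrN1.
by rewrite /scalar_abs (normrN1 R[i]).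
Qed.

Lemma scalar_abs_nat n : scalar_abs (n%:R : Defs.scalar R s) = n%:R.
Proof.
case: s; first exact: normr_nat.
by rewrite /scalar_abs (normr_nat R[i]) -(rmorph_nat (@real_complex R)).
Qed.

Lemma anormN a : anorm (- a) = anorm a.
Proof. by rewrite -scaleN1r anormZ scalar_absN1 mul1r. Qed.

Lemma anorm_mulrn a n : anorm (a *+ n) = anorm a *+ n.
Proof. by rewrite -scaler_nat anormZ scalar_abs_nat mulr_natl. Qed.

Lemma anorm0 : anorm (0 : A) = 0.
Proof. by rewrite -(mulr0n (0 : A)) anorm_mulrn. Qed.

Lemma anorm_ge0 a : 0 <= anorm a.
Proof.
have := anormD_le a (- a).
by rewrite subrr anorm0 anormN -mulr2n pmulrn_lge0.
Qed.

Lemma anormB_le a b : anorm (a - b) <= anorm a + anorm b.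
Proof. by rewrite (le_trans (anormD_le _ _)) ?anormN. Qed.

Lemma anorm_distC a b : anorm (a - b) = anorm (b - a).
Proof. by rewrite -anormN opprB. Qed.

Lemma anorm_sum_le I (r : seq I) (P : pred I) (F : I -> A) :
  anorm (\sum_(i <- r | P i) F i) <= \sum_(i <- r | P i) anorm (F i).
Proof.
apply: (big_ind2 (fun (x : A) (y : R) => anorm x <= y)) => //.
- by rewrite anorm0.
- by move=> x1 y1 x2 y2 h1 h2; rewrite (le_trans (anormD_le _ _)) ?lerD.
Qed.

Lemma anorm1_ge1 : 1 <= anorm (1 : A).
Proof.
have n0 : anorm (1 : A) != 0.
  by apply/eqP => /anorm0_eq0/eqP; rewrite oner_eq0.
have n1 : 0 < anorm (1 : A) by rewrite lt_def n0 anorm_ge0.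
by have := anormM_le (1 : A) 1; rewrite mulr1 ler_pMr.
Qed.

End AlgebraNorm.

(** * Differences of a power bounded operator *)

Definition power_bounded {R : realType} {s : scalar_kind} {A : banachAlgType R s}
    (M : R) (T : A -> A) : Prop :=
  forall n x, anorm (iter n T x) <= M * anorm x.

Definition opdiff {V : zmodType} (T : V -> V) (x : V) : V := T x - x.

Lemma iterB {V : zmodType} (f : V -> V) n x y :
  additive f -> iter n f (x - y) = iter n f x - iter n f y.
Proof. by move=> fB; elim: n => //= n ->; rewrite fB. Qed.

Section PowerBounded.
Context {R : realType} {s : scalar_kind} {A : banachAlgType R s}.
Variables (M : R) (T : {additive A -> A}).
Hypotheses (M1 : 1 <= M) (TM : power_bounded M T).
Local Notation D := (opdiff T).
Local Notation "`D_ k" := (fun x => anorm (iter k D x)) (at level 0, k at level 2).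

Let M0 : 0 <= M. Proof. exact: le_trans ler01 M1. Qed.

Lemma opdiff_is_additive : additive D.
Proof.
move=> x y; rewrite /opdiff raddfB !opprB addrACA [RHS]addrACA.
by congr (_ + _); rewrite addrC.
Qed.

Lemma anorm_opdiff_le x : anorm (D x) <= (M + 1) * anorm x.
Proof.
rewrite mulrDl mul1r (le_trans (anormB_le _ _)) ?lerD2r//.
exact: (TM 1%N).
Qed.

(** The telescoping sum [T^m - 1 = (1 + T + ... + T^(m-1)) (T - 1)]. *)
Lemma anorm_iter_sub_le m x : anorm (iter m T x - x) <= m%:R * M * anorm (D x).
Proof.
elim: m => [|m IH]; first by rewrite subrr anorm0 !mul0r.
have -> : iter m.+1 T x - x = iter m T (D x) + (iter m T x - x).
  rewrite /opdiff iterB -?iterSr; last exact: raddfB.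
  by rewrite addrA subrK.
rewrite (le_trans (anormD_le _ _))// -natr1 addrC !mulrDl mul1r.
by rewrite lerD.
Qed.

(** A first order Taylor formula for [m |-> T^m x]: the remainder telescopes
    into the increments [(T^i - 1) (D x)], [i < m], each of which is bounded by
    [i M |D^2 x|]. *)
Lemma anorm_iter_taylor_le m x :
  anorm (iter m T x - x - D x *+ m) <= m%:R ^+ 2 * M * anorm (D (D x)).
Proof.
elim: m => [|m IH]; first by rewrite mulr0n subr0 subrr anorm0 expr0n !mul0r.
have -> : iter m.+1 T x - x - D x *+ m.+1 =
    (iter m T (D x) - D x) + (iter m T x - x - D x *+ m).
  rewrite {2}/opdiff iterB -?iterSr; last exact: raddfB.
  rewrite mulrS opprD !addrA; congr (_ - _).
  by rewrite (addrAC _ (- D x) (iter m T x)) addrNK addrAC.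
rewrite (le_trans (anormD_le _ _))//.
apply: le_trans (lerD (anorm_iter_sub_le m (D x)) IH) _.
have := anorm_ge0 (D (D x)); set d := anorm _ => d0.
rewrite -!mulrDl !ler_wpM2r// -natr1.
by have := ler0n R m; nra.
Qed.

(** As [T^m x] stays bounded, its linear part [m D x] is bounded by [|x|] up to
    the Taylor remainder: [m |D x| <= (M + 1) |x| + m^2 M |D^2 x|].  Choosing [m]
    so that the left side is comparable to twice the first term on the right
    makes the remainder dominate, which is the claim. *)
Lemma landau_kolmogorov x :
  anorm (D x) ^+ 2 <= 9 * M * (M + 1) * (anorm x * anorm (D (D x))).
Proof.
have := anorm_ge0 x; have := anorm_ge0 (D (D x)); have := anorm_ge0 (D x).
rewrite le_eqVlt => /predU1P[<- d2 d0|d1 d2 d0].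
  by rewrite expr0n /= !mulr_ge0// addr_ge0.
set K := (M + 1) * anorm x.
have K1 : anorm (D x) <= K by exact: anorm_opdiff_le.
have K0 : 0 < K by exact: lt_le_trans K1.
(* [m |D x|] lies between [2 K] and [3 K]: rounding up costs at most [|D x|],
   which is at most [K]. *)
pose m := (Num.truncn (2 * K / anorm (D x))).+1.
have [m1 m2] : 2 * K <= m%:R * anorm (D x) /\ m%:R * anorm (D x) <= 3 * K.
  have q0 : 0 <= 2 * K / anorm (D x).
    by apply: divr_ge0 (ltW d1); apply: mulr_ge0 (ltW K0).
  split.
    by rewrite -ler_pdivrMr// ltW// truncnS_gt.
  rewrite -(natr1 (Num.truncn _)) mulrDl mul1r.
  rewrite (_ : 3 * K = 2 * K + K); last by ring.
  by rewrite lerD// -ler_pdivlMr// truncn_le.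
have : m%:R * anorm (D x) <= K + m%:R ^+ 2 * M * anorm (D (D x)).
  rewrite mulr_natl -anorm_mulrn.
  have -> : D x *+ m = (iter m T x - x) - (iter m T x - x - D x *+ m).
    by rewrite subKr.
  apply: le_trans (anormB_le _ _) (lerD _ (anorm_iter_taylor_le _ _)).
  by rewrite /K mulrDl mul1r (le_trans (anormB_le _ _)) ?lerD2r.
move: m1 m2; move: (m%:R : R) (anorm (D x)) (anorm (D (D x))) d1 d2 K0.
move=> z u w u0 w0 K0 h1 h2 h3.
have hK : K <= z ^+ 2 * M * w by lra.
have : u ^+ 2 * K <= 9 * K ^+ 2 * (M * w).
  apply: le_trans (_ : u ^+ 2 * (z ^+ 2 * M * w) <= _).
    by rewrite ler_wpM2l// exprn_ge0// ltW.
  rewrite (_ : u ^+ 2 * _ = (z * u) ^+ 2 * (M * w)); last by ring.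
  rewrite ler_wpM2r ?mulr_ge0//.
  rewrite (_ : 9 * _ = (3 * K) ^+ 2); last by ring.
  by rewrite lerXn2r ?nnegrE; lra.
rewrite (_ : 9 * K ^+ 2 * _ = 9 * K * (M * w) * K); last by ring.
rewrite ler_pM2r// => h; apply: le_trans h _.
by apply: ler_of_eq; rewrite /K; ring.
Qed.

Let c := 9 * M * (M + 1).

Let c0 : 0 <= c. Proof. by rewrite /c !mulr_ge0// addr_ge0. Qed.

(** The Landau-Kolmogorov inequality, applied to the elements [D^i x], says that
    [i |-> |D^i x|] is log-convex up to the factor [c]; ratios of consecutive
    terms are therefore nondecreasing up to powers of [c]. *)
Lemma diff1_mul_diff_le j x :
  anorm (D x) * `D_j x <= c ^+ j * (anorm x * `D_j.+1 x).
Proof.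
elim: j => [|j IH]; first by rewrite expr0 mul1r mulrC.
have := anorm_ge0 (iter j.+1 D x); rewrite le_eqVlt => /predU1P[<-|d0].
  by rewrite mulr0 !mulr_ge0 ?exprn_ge0 ?anorm_ge0.
rewrite -(ler_pM2r d0) -mulrA -expr2.
apply: le_trans (ler_wpM2l (anorm_ge0 _) (landau_kolmogorov (iter j D x))) _.
apply: le_trans (_ : c * (anorm (D x) * `D_j x) * `D_j.+2 x <= _).
  by apply: ler_of_eq; rewrite /= /c; ring.
apply: le_trans (ler_wpM2r (anorm_ge0 _) (ler_wpM2l c0 IH)) _.
by apply: ler_of_eq; rewrite /= exprS; ring.
Qed.

(** Induction on [i]: multiply the case [i] by the comparison
    [d_(i+1) d_(i+j) <= c^j d_i d_(i+j+1)] of consecutive ratios, where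
    [d_i = |D^i x|], and cancel [d_i] against [d_(i+j)]. *)
Lemma diff_mul_diff_le i j x :
  `D_i x * `D_j x <= c ^+ (i * j) * (anorm x * `D_(i + j) x).
Proof.
elim: i => [|i IH]; first by rewrite mul0n expr0 mul1r.
(* When the term to be cancelled vanishes, so does the left side. *)
have := anorm_ge0 (iter (i + j) D x); rewrite le_eqVlt => /predU1P[d0|d0].
  have ij0 : `D_i x * `D_j x = 0.
    apply/eqP; rewrite eq_le mulr_ge0 ?anorm_ge0// andbT.
    by rewrite (le_trans IH)// -d0 !mulr0.
  apply: le_trans (_ : 0 <= _); last first.
    by rewrite !mulr_ge0 ?exprn_ge0 ?anorm_ge0.
  apply: le_trans (ler_wpM2r (anorm_ge0 _) (anorm_opdiff_le (iter i D x))) _.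
  by rewrite -mulrA ij0 mulr0.
rewrite -(ler_pM2r d0).
have := diff1_mul_diff_le j (iter i D x).
rewrite -!iterD addSn addnC => h.
apply: le_trans (_ : (anorm (iter i.+1 D x) * `D_(i + j) x) * `D_j x <= _).
  by apply: ler_of_eq; ring.
rewrite [iter i.+1 _ _]/= in h *.
apply: le_trans (ler_wpM2r (anorm_ge0 _) h) _.
apply: le_trans (_ : c ^+ j * `D_(i.+1 + j) x * (`D_i x * `D_j x) <= _).
  by apply: ler_of_eq; rewrite addSn; ring.
apply: le_trans (ler_wpM2l _ IH) _.
  by rewrite mulr_ge0 ?exprn_ge0 ?anorm_ge0.
by apply: ler_of_eq; rewrite mulSn exprD; ring.
Qed.

(** Smallness of a single higher difference forces smallness of the first one;
    this is how a bound on Besov quotients is turned into continuity. *)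
Lemma diff1_pow_le k x :
  anorm (D x) ^+ k.+1 <=
  c ^+ 'C(k.+1, 2) * (anorm x ^+ k * anorm (iter k.+1 D x)).
Proof.
elim: k => [|k IH]; first by rewrite bin_small// !expr0 !mul1r.
rewrite exprS; apply: le_trans (ler_wpM2l (anorm_ge0 _) IH) _.
apply: le_trans (_ : c ^+ 'C(k.+1, 2) * anorm x ^+ k *
  (anorm (D x) * anorm (iter k.+1 D x)) <= _); first by apply: ler_of_eq; ring.
apply: le_trans (ler_wpM2l _ (diff1_mul_diff_le k.+1 x)) _.
  by rewrite mulr_ge0 ?exprn_ge0 ?anorm_ge0.
apply: ler_of_eq.
by rewrite [in RHS]binS bin1 exprD [anorm x ^+ k.+1]exprS; ring.
Qed.

End PowerBounded.

(** * Differences of an inverse under a ring endomorphism *)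

Section Reciprocal.
Context {R : realType} {s : scalar_kind} {A : banachAlgType R s}.
Variable (T : {rmorphism A -> A}).
Local Notation D := (opdiff T).

Lemma opdiffM x y : D (x * y) = D x * T y + x * D y.
Proof. by rewrite /opdiff rmorphM mulrBl mulrBr addrA subrK. Qed.

Lemma opdiff_iter_comm j x : D (iter j T x) = iter j T (D x).
Proof.
by elim: j => //= j <-; rewrite /opdiff raddfB.
Qed.

(** The twisted product rule [D (x y) = D x * T y + x * D y], iterated as in the
    binomial theorem; [T] and [D] commute, so the twists collect into [T^j]. *)
Lemma leibniz_iter_opdiff k x y :
  iter k D (x * y) =
  \sum_(j < k.+1) (iter j D x * iter j T (iter (k - j) D y)) *+ 'C(k, j).
Proof.
elim: k => [|k IH]; first by rewrite big_ord1.
pose P j := iter j D x * iter j T (iter (k.+1 - j) D y).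
have -> : iter k.+1 D (x * y) =
    \sum_(j < k.+1) (P j *+ 'C(k, j) + P j.+1 *+ 'C(k, j)).
  rewrite iterS {}IH.
  have -> : forall F : 'I_k.+1 -> A, D (\sum_j F j) = \sum_j D (F j).
    by move=> F; rewrite /opdiff raddf_sum sumrB.
  apply: eq_bigr => -[j jk] _ /=.
  have -> : forall z n, D (z *+ n) = D z *+ n.
    by move=> z n; rewrite /opdiff raddfMn mulrnBl.
  by rewrite opdiffM opdiff_iter_comm -mulrnDl addrC /P (@subSn j k jk) subSS.
rewrite big_split /= big_ord_recl [RHS]big_ord_recl -addrA; congr (_ + _).
  by rewrite !bin0.
under [RHS]eq_bigr do rewrite binS mulrnDr.
rewrite big_split /= [X in _ = X + _]big_ord_recr/= bin_small// mulr0n addr0.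
by [].
Qed.

Lemma iter_opdiff1 k : iter k.+1 D 1 = 0.
Proof.
elim: k => [|k IH]; first by rewrite /= /opdiff rmorph1 subrr.
by rewrite iterS IH /opdiff raddf0 subrr.
Qed.

(** In the Leibniz expansion of [0 = D^(k+1) (a b)] the term without a difference
    on [a] is [a D^(k+1) b]; solve for it and multiply by [b]. *)
Lemma anorm_iter_opdiff_inverse_le (M : R) k a b :
  power_bounded M T -> a * b = 1 -> b * a = 1 ->
  anorm (iter k.+1 D b) <=
  anorm b * \sum_(j < k.+1)
    (anorm (iter j.+1 D a) * (M * anorm (iter (k - j) D b))) *+ 'C(k.+1, j.+1).
Proof.
move=> TM ab ba.
have aDb : a * iter k.+1 D b =
    - \sum_(j < k.+1) (iter j.+1 D a * iter j.+1 T (iter (k - j) D b))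
                       *+ 'C(k.+1, j.+1).
  apply/eqP; rewrite -addr_eq0; apply/eqP.
  have := leibniz_iter_opdiff k.+1 a b.
  by rewrite ab iter_opdiff1 big_ord_recl bin0 mulr1n => /esym.
have -> : iter k.+1 D b = b * (a * iter k.+1 D b) by rewrite mulrA ba mul1r.
rewrite aDb (le_trans (anormM_le _ _))// ler_wpM2l ?anorm_ge0// anormN.
rewrite (le_trans (anorm_sum_le _ _ _ _))// ler_sum// => j _.
rewrite anorm_mulrn ler_wMn2r//.
by rewrite (le_trans (anormM_le _ _))// ler_wpM2l ?anorm_ge0// (TM j.+1).
Qed.

End Reciprocal.

(** The pointwise norm control.  The constant has to be uniform in [T], because
    the lemma is used for all [psi_t] at once. *)
Lemma reciprocal_difference_le {R : realType} {s : scalar_kind}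
    (A : banachAlgType R s) (M : R) (n : nat) : 1 <= M ->
  exists2 C : R, 0 <= C &
    forall (T : {rmorphism A -> A}) (a b : A) k,
      power_bounded M T -> a * b = 1 -> b * a = 1 -> (k < n)%N ->
      anorm (iter k.+1 (opdiff T) b) <=
        C * anorm b ^+ 2 * anorm (iter k.+1 (opdiff T) a) *
          \sum_(m < k.+1) (anorm b * anorm a) ^+ m.
Proof.
move=> M1; have M0 : 0 <= M by exact: le_trans ler01 M1.
pose c := 9 * M * (M + 1).
have c1 : 1 <= c by rewrite /c; have := mulr_ge0 M0 M0; lra.
have c0 : 0 <= c := le_trans ler01 c1.
elim: n => [|n [C C0 IH]]; first by exists 0.
pose C' := C * c ^+ (n.+1 * n.+1) + 1.
have C'0 : 0 <= C' by rewrite addr_ge0// mulr_ge0// exprn_ge0.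
pose B : R := \sum_(j < n.+1) 'C(n.+1, j.+1)%:R.
have B0 : 0 <= B by apply: sumr_ge0.
have MBC : 0 <= M * B * C' by rewrite !mulr_ge0.
exists (C + M * B * C'); first by rewrite addr_ge0.
move=> T a b k TM ab ba kn.
set S := \sum_(m < k.+1) _.
set u := anorm b.
have S0 : 0 <= S by apply: sumr_ge0 => m _; rewrite exprn_ge0// mulr_ge0 ?anorm_ge0.
pose X := u ^+ 2 * anorm (iter k.+1 (opdiff T) a) * S.
have X0 : 0 <= X by rewrite !mulr_ge0 ?exprn_ge0 ?anorm_ge0.
have -> : (C + M * B * C') * u ^+ 2 * anorm (iter k.+1 (opdiff T) a) * S =
    C * X + M * B * C' * X by rewrite /X; ring.
move: kn; rewrite ltnS leq_eqVlt => /predU1P[kn|kn]; last first.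
  apply: le_trans (IH T a b k TM ab ba kn) _.
  rewrite -/u -/S -mulrA -mulrA [u ^+ 2 * _]mulrA -/X.
  by rewrite lerDl mulr_ge0.
apply: ler_wpDl; first by rewrite mulr_ge0.
apply: le_trans (anorm_iter_opdiff_inverse_le _ _ k _ _ TM ab ba) _.
subst n.
have S1 : 1 <= S.
  rewrite /S big_ord_recl expr0 lerDl sumr_ge0// => m _.
  by rewrite exprn_ge0// mulr_ge0 ?anorm_ge0.
(* The term [j = k] has no difference on [b].  For the others, the induction
   hypothesis produces [u |a|] times a shorter geometric sum, the factor [|a|]
   coming from interpolation; this is part of [S] again. *)
have key (j : 'I_k.+1) :
    anorm (iter j.+1 (opdiff T) a) * anorm (iter (k - j) (opdiff T) b) <=
    C' * (u * anorm (iter k.+1 (opdiff T) a) * S).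
  have D0 := anorm_ge0 (iter k.+1 (opdiff T) a).
  have uDS0 : 0 <= u * anorm (iter k.+1 (opdiff T) a) * S.
    by rewrite !mulr_ge0 ?anorm_ge0.
  have := ltn_ord j; rewrite ltnS leq_eqVlt => /predU1P[->|jk].
    rewrite subnn /= -/u mulrC mulrDl mul1r.
    rewrite (@le_trans _ _ (u * anorm (iter k.+1 (opdiff T) a) * S))//.
      by rewrite ler_peMr// mulr_ge0 ?anorm_ge0.
    by rewrite lerDr !mulr_ge0 ?exprn_ge0 ?anorm_ge0.
  have [i ki] : exists i, (k - j = i.+1)%N.
    by exists (k - j).-1; rewrite prednK// subn_gt0.
  have ik : (i < k)%N by rewrite -ki leq_subr.
  rewrite ki; set Si := \sum_(m < i.+1) (u * anorm a) ^+ m.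
  have Si0 : 0 <= Si.
    by apply: sumr_ge0 => m _; rewrite exprn_ge0// mulr_ge0 ?anorm_ge0.
  have SiS : u * anorm a * Si <= S.
    have ik1 : (i.+2 <= k.+1)%N by [].
    rewrite /S -(subnKC ik1) big_split_ord/= big_ord_recl.
    apply: ler_wpDr.
      by apply: sumr_ge0 => m _; rewrite exprn_ge0// mulr_ge0 ?anorm_ge0.
    apply: ler_wpDl; first by rewrite exprn_ge0// mulr_ge0 ?anorm_ge0.
    by rewrite /Si mulr_sumr ler_sum// => m _; rewrite -exprS.
  have h1 := IH T a b i TM ab ba ik.
  have h2 := diff_mul_diff_le M T M1 TM j.+1 i.+1 a.
  have e : (j.+1 + i.+1 = k.+1)%N by rewrite addSn -ki subnKC// ltnW.
  rewrite e in h2.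
  apply: le_trans (ler_wpM2l (anorm_ge0 _) h1) _.
  rewrite -/u -/Si.
  set p := anorm (iter j.+1 _ a) in h2 *; set q := anorm (iter i.+1 _ a) in h2 *.
  apply: (@le_trans _ _ (C * u ^+ 2 * Si * (p * q))).
    by apply: ler_of_eq; ring.
  have pos : 0 <= C * u ^+ 2 * Si by rewrite !mulr_ge0 ?exprn_ge0 ?anorm_ge0.
  apply: le_trans (ler_wpM2l pos h2) _.
  set d := anorm (iter k.+1 _ a) in D0 uDS0 *.
  have h3 : c ^+ (j.+1 * i.+1) <= c ^+ (k.+1 * k.+1).
    apply: ler_weXn2l => //; apply: leq_mul; last exact: ltnW.
    exact: ltn_ord.
  apply: (@le_trans _ _ (C * c ^+ (j.+1 * i.+1) * (u * d * (u * anorm a * Si)))).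
    by apply: ler_of_eq; rewrite /c; ring.
  rewrite /C' mulrDl mul1r; apply: ler_wpDr => //.
  apply: ler_pM; rewrite ?mulr_ge0 ?exprn_ge0 ?anorm_ge0//.
    by rewrite ler_wpM2l.
  by rewrite ler_wpM2l// mulr_ge0 ?anorm_ge0.
apply: (@le_trans _ _ (u * \sum_(j < k.+1)
    (M * (C' * (u * anorm (iter k.+1 (opdiff T) a) * S))) *+ 'C(k.+1, j.+1))).
  rewrite ler_wpM2l ?anorm_ge0// ler_sum// => j _.
  by rewrite ler_wMn2r// mulrCA ler_wpM2l.
apply: ler_of_eq.
under eq_bigr do rewrite -mulr_natr.
by rewrite -mulr_sumr -/B /X; ring.
Qed.

(** * Pairs of times at a prescribed distance *)

Lemma lebesgue_measure_shift {R : realType} (h : R) (X : set R) :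
  measurable X ->
  lebesgue_measure ((fun t : R => t - h) @^-1` X) = lebesgue_measure X.
Proof.
move=> mX; pose f : R -> measurableTypeR R := fun t => t - h.
have mf : measurable_fun [set: R] f by exact: measurable_funB.
rewrite -[LHS]/(pushforward lebesgue_measure f X).
apply/esym/lebesgue_measure_unique => //= _ [[a b]] _ <-.
rewrite /pushforward (_ : f @^-1` _ = `]a + h, b + h]%classic); last first.
  by apply/seteqP; split => x /=; rewrite !in_itv/= /f ltrBrDr lerBlDr.
rewrite !lebesgue_measure_itv/= !lte_fin ltrD2r; case: ifP => // _.
by rewrite -!EFinB; congr EFin; ring.
Qed.

Lemma measurable_powR_div {R : realType} (f : R -> R) (q : R) :
  measurable_fun [set: R] f ->
  measurable_fun [set: R] (fun t => (f t `^ q / `|t|)%:E).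
Proof.
move=> mf; apply/measurable_EFinP; apply: measurable_funM.
  exact: measurableT_comp (measurable_powR _) mf.
rewrite (_ : (fun t : R => `|t|^-1) = (fun t : R => `|t| `^ -1)).
  exact: measurableT_comp (measurable_powR _) _.
by apply/funext => t; rewrite powR_inv1.
Qed.

(** By Markov's inequality with weight [1/|t| >= 1/(2h)], the set [S] of times in
    [(0, 2h)] at which [f > L] has measure less than [h/2] once [L > 4 I], where
    [I] is the integral; here [L <= L^q] is used.  Hence [S] and its translate
    by [h] cannot cover [(h, 2h)]. *)
Lemma shifted_pair_bounded {R : realType} (f : R -> R) (q : R) :
  1 <= q -> measurable_fun [set: R] f -> (forall t, 0 <= f t) ->
  (\int[lebesgue_measure]_(t in [set: R]) (f t `^ q / `|t|)%:E < +oo)%E ->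
  exists2 L : R, 0 <= L & forall h : R, 0 < h ->
    exists t : R, [/\ h < t, t < 2 * h, f t <= L & f (t - h) <= L].
Proof.
move=> q1 mf f0.
set J := integral _ _ _ => Jy.
have J0 : (0 <= J)%E.
  by apply: integral_ge0 => t _; rewrite lee_fin divr_ge0 ?powR_ge0.
have Jfin : J \is a fin_num by rewrite ge0_fin_numE.
pose I := fine J; have I0 : 0 <= I by exact: fine_ge0.
pose L := 4 * I + 1; have L1 : 1 <= L by rewrite /L; lra.
exists L => [|h h0]; first exact: le_trans ler01 L1.
apply: contrapT => nt.
pose S : set R := `]0, 2 * h[%classic `&` [set t | L < f t].
have mS : measurable S.
  rewrite /S (_ : [set t | L < f t] =
      [set: R] `&` f @^-1` `]L, +oo[%classic).
    by apply: measurableI => //; apply: mf.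
  by rewrite setTI; apply/seteqP; split => x /=; rewrite in_itv/= andbT.
have muS : ((L / (2 * h))%:E * lebesgue_measure S <= J)%E.
  have mF := measurable_powR_div f q mf.
  rewrite -integral_cst//.
  apply: (@le_trans _ _ (\int[lebesgue_measure]_(t in S) (f t `^ q / `|t|)%:E)%E).
    apply: ge0_le_integral => //.
    - move=> t _; rewrite lee_fin divr_ge0//; lra.
    - exact: measurable_funS mF.
    - move=> t [] /=; rewrite in_itv/= => /andP[t0 th] Lf.
      rewrite lee_fin gtr0_norm// ler_pM ?invr_ge0//.
      + lra.
      + lra.
      + apply: le_trans (ltW Lf) _.
        by rewrite -{1}(powRr1 (f0 t)) ler_powR//; lra.
      + by rewrite lef_pV2 ?posrE ?mulr_gt0// ltW.
  by apply: ge0_subset_integral => // t _; rewrite lee_fin divr_ge0 ?powR_ge0.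
pose S' := (fun t : R => t - h) @^-1` S.
have mS' : measurable S'.
  rewrite -[X in measurable X]setTI.
  have : measurable_fun [set: R] (fun t : R => t - h) by exact: measurable_funB.
  by apply.
have : (lebesgue_measure (`]h, (2 * h)%R[%classic : set R) <=
        lebesgue_measure (S `|` S'))%E.
  apply: le_measure; rewrite ?inE//; first exact: measurableU.
  move=> t /=; rewrite in_itv/= => /andP[ht th].
  have [ft|ft] := ltP L (f t).
    by left; split => //=; rewrite in_itv/= (lt_trans h0 ht).
  right; split => /=; first by rewrite in_itv/=; apply/andP; split; lra.
  by rewrite ltNge; apply/negP => fth; apply: nt; exists t.
apply/negP; rewrite -ltNge.
have S'S : lebesgue_measure S' = lebesgue_measure S by exact: lebesgue_measure_shift.
have Sfin : lebesgue_measure S \is a fin_num.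
  rewrite ge0_fin_numE//.
  apply: le_lt_trans (_ : (lebesgue_measure (`]0%R, (2 * h)%R[%classic : set R) < +oo)%E).
    by apply: le_measure; rewrite ?inE// /S; exact: subIsetl.
  by rewrite lebesgue_measure_itv/=; case: ifP => _; rewrite ?ltry.
apply: le_lt_trans (measureU2 _ _ _) _ => //.
rewrite [X in (_ + X)%E]S'S lebesgue_measure_itv/= lte_fin.
move: muS; rewrite -[J]fineK// -(fineK Sfin) -EFinM -EFinD lee_fin -/I.
set x := fine _ => hx.
rewrite ifT; last lra.
rewrite lte_fin; move: hx.
rewrite mulrAC ler_pdivrMr; last lra.
have x0 : 0 <= x by exact: fine_ge0.
rewrite /L; nra.
Qed.

(** * Continuity of orbits *)

Lemma squeeze0 {R : realType} (F : set_system R) (f g : R -> R) : Filter F ->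
  (forall x, 0 <= f x <= g x) -> g x @[x --> F] --> (0 : R) ->
  f x @[x --> F] --> (0 : R).
Proof.
move=> FF fg g0; apply: (squeeze_cvgr _ (cvg_cst 0) g0).
exact: nearW.
Qed.

Section AutomorphismGroup.
Context {R : realType} {s : scalar_kind} {A : banachAlgType R s}.
Variable Psi : automorphism_group A.
Local Notation "'Delta_ t" := (difference Psi t) (at level 0, t at level 2).
Implicit Types (a b x y : A) (t h : R).

Lemma differenceB t a b : 'Delta_t (a - b) = 'Delta_t a - 'Delta_t b.
Proof. exact: (opdiff_is_additive (Psi t)). Qed.

Lemma autB t a b : Psi t (a - b) = Psi t a - Psi t b.
Proof. exact: raddfB. Qed.

Lemma aut0 a : Psi 0 a = a.
Proof. by apply: (bij_inj (aut_bij Psi 0)); rewrite autD addr0. Qed.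

Lemma iter_aut n t a : iter n (Psi t) a = Psi (t *+ n) a.
Proof.
elim: n => [|n IH]; first by rewrite mulr0n aut0.
by rewrite iterS IH autD mulrS.
Qed.

Lemma aut_power_bounded :
  exists2 M : R, 1 <= M & forall t, power_bounded M (Psi t).
Proof.
have [M0 PM] := aut_bounded Psi; exists (Num.max 1 M0); first by rewrite le_max lexx.
move=> t n x; rewrite iter_aut; apply: le_trans (PM _ _) _.
by rewrite ler_wpM2r ?anorm_ge0// le_max lexx orbT.
Qed.

(** Continuity at [0] of the orbit map [t |-> psi_t a], which by the group law is
    continuity everywhere. *)
Definition orbit_continuous a : Prop :=
  (fun h => anorm ('Delta_h a)) @ (0 : R) --> (0 : R).

Lemma orbit_continuous_aut t a : orbit_continuous a -> orbit_continuous (Psi t a).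
Proof.
have [M _ PM] := aut_power_bounded.
move=> ca; apply: (@squeeze0 _ _ _ (fun h => M * anorm ('Delta_h a))).
  move=> h; rewrite anorm_ge0/= /difference autD (addrC h t) -autD -autB.
  exact: (PM t 1%N).
by rewrite -[X in _ --> X](mulr0 M); apply: cvgM => //; exact: cvg_cst.
Qed.

Lemma orbit_continuousB a b :
  orbit_continuous a -> orbit_continuous b -> orbit_continuous (a - b).
Proof.
move=> ca cb.
apply: (@squeeze0 _ _ _ (fun h => anorm ('Delta_h a) + anorm ('Delta_h b))).
  by move=> h; rewrite anorm_ge0/= differenceB anormB_le.
by rewrite -[X in _ --> X](addr0 0); apply: cvgD.
Qed.

Lemma orbit_continuous_at t a : orbit_continuous a ->
  (fun t' => anorm (Psi t' a - Psi t a)) @ t --> (0 : R).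
Proof.
have [M _ PM] := aut_power_bounded.
move=> ca; apply: (@squeeze0 _ _ _ (fun t' => M * anorm ('Delta_(t' - t) a))).
  move=> t'; rewrite anorm_ge0/=.
  have -> : Psi t' a - Psi t a = Psi t ('Delta_(t' - t) a).
    by rewrite /difference autB autD (addrC t) subrK.
  exact: (PM t 1%N).
rewrite -[X in _ --> X](mulr0 M); apply: cvgM; first exact: cvg_cst.
apply: (cvg_comp (fun t' => t' - t) (fun h => anorm ('Delta_h a)) _ ca).
have : t' - t @[t' --> t] --> t - t by apply: cvgB => //; exact: cvg_cst.
by rewrite subrr.
Qed.

(** The resolvent-type identity
    [psi_h b - b = - psi_h b (psi_h a - a) b]. *)
Lemma orbit_continuous_inverse a b :
  a * b = 1 -> b * a = 1 -> orbit_continuous a -> orbit_continuous b.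
Proof.
have [M M1 PM] := aut_power_bounded.
move=> ab ba ca.
apply: (@squeeze0 _ _ _ (fun h => M * anorm b ^+ 2 * anorm ('Delta_h a))).
  move=> h; rewrite anorm_ge0/=.
  have -> : 'Delta_h b = - (Psi h b * 'Delta_h a * b).
    rewrite /difference mulrBr -(rmorphM (Psi h)) ba (rmorph1 (Psi h)).
    by rewrite mulrBl mul1r -mulrA ab mulr1 opprB.
  rewrite anormN; apply: le_trans (anormM_le _ _) _.
  apply: le_trans (ler_wpM2r (anorm_ge0 _) (anormM_le _ _)) _.
  have hb : anorm (Psi h b) <= M * anorm b := PM h 1%N b.
  rewrite -[leLHS]mulrA; apply: le_trans (ler_wpM2r _ hb) _.
    by rewrite mulr_ge0 ?anorm_ge0.
  by apply: ler_of_eq; ring.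
rewrite -[X in _ --> X](mulr0 (M * anorm b ^+ 2)).
by apply: cvgM => //; exact: cvg_cst.
Qed.

(** Induction on [k], splitting the variation of [D_t' (D_t'^k a)] into the
    variation of the argument and that of the operator at the fixed vector
    [y = D_t^k a], whose orbit is continuous as well. *)
Lemma iter_difference_continuous k t a : orbit_continuous a ->
  (fun t' => anorm (iter k 'Delta_t' a - iter k 'Delta_t a)) @ t --> (0 : R).
Proof.
have [M M1 PM] := aut_power_bounded.
move=> ca; elim: k => [|k IH].
  rewrite (_ : (fun _ => _) = (fun _ : R => 0)); first exact: cvg_cst.
  by apply/funext => t'; rewrite subrr anorm0.
have cD n : orbit_continuous (iter n 'Delta_t a).
  elim: n => //= n IHn; apply: orbit_continuousB => //.
  exact: orbit_continuous_aut.
set y := iter k 'Delta_t a in IH *.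
apply: (@squeeze0 _ _ _ (fun t' => (M + 1) * anorm (iter k 'Delta_t' a - y)
                        + anorm (Psi t' y - Psi t y))).
  move=> t'; rewrite anorm_ge0/=.
  have -> : 'Delta_t' (iter k 'Delta_t' a) - 'Delta_t y =
    'Delta_t' (iter k 'Delta_t' a - y) + (Psi t' y - Psi t y).
    rewrite differenceB -[RHS]addrA; congr (_ + _).
    by rewrite /difference !opprB addrA subrK.
  rewrite (le_trans (anormD_le _ _))// lerD2r.
  exact: (anorm_opdiff_le M (Psi t') (PM t')).
rewrite -[X in _ --> X](addr0 0); apply: cvgD; last exact: orbit_continuous_at (cD k).
by rewrite -[X in _ --> X](mulr0 (M + 1)); apply: cvgM; [exact: cvg_cst|exact: IH].
Qed.

Lemma measurable_besov_quotient r a :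
  orbit_continuous a -> measurable_fun [set: R] (besov_quotient Psi r a).
Proof.
move=> ca; apply: measurable_funM.
  exact: measurableT_comp (measurable_powR _) _.
apply: continuous_measurable_fun => t.
apply/cvgrPdist_le => e e0.
have /cvgrPdist_le /(_ e e0) := iter_difference_continuous (besov_order r) t a ca.
apply: filterS => t'; rewrite sub0r normrN ger0_norm ?anorm_ge0//.
apply: le_trans; rewrite anorm_distC.
set u := iter _ _ a; set v := iter _ _ a.
have := anormD_le (u - v) v; have := anormD_le (v - u) u.
rewrite !subrK (anorm_distC v u) => h1 h2.
by rewrite ler_norml; apply/andP; split; lra.
Qed.

(** Finiteness of the integral makes the Besov quotient bounded at two small
    times at distance [h].  There the first differences are
    small by [diff1_pow_le], and [psi_h a - a] is, up to an automorphism, the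
    difference of these two first differences.  The result is the Hoelder type
    bound [|psi_h a - a|^(k+1) <= K |h|^r], with [k = truncn r]. *)
Lemma besov_orbit_continuous (q r : R) a : 1 <= q -> 0 < r ->
  besov Psi q%:E r a -> orbit_continuous a.
Proof.
move=> q1 r0 [/(_ isT) mQ finN].
have [M M1 PM] := aut_power_bounded.
have M0 : 0 <= M := le_trans ler01 M1.
have Q0 t : 0 <= besov_quotient Psi r a t by rewrite mulr_ge0 ?powR_ge0 ?anorm_ge0.
have [L L0 pairs] : exists2 L : R, 0 <= L & forall h : R, 0 < h -> exists t : R,
    [/\ h < t, t < 2 * h, besov_quotient Psi r a t <= L
      & besov_quotient Psi r a (t - h) <= L].
  apply: (shifted_pair_bounded _ q) => //.
  apply: (@lty_poweRy _ _ q^-1); first by rewrite invr_neq0// gt_eqF//; lra.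
  apply: le_lt_trans finN; rewrite /besov_norm /besov_seminorm.
  by rewrite leeDr// lee_fin anorm_ge0.
pose k := Num.truncn r.
have c0 : 0 <= 9 * M * (M + 1) by rewrite !mulr_ge0// addr_ge0.
pose C := (9 * M * (M + 1)) ^+ 'C(k.+1, 2) * anorm a ^+ k * L.
have C0 : 0 <= C by rewrite !mulr_ge0 ?exprn_ge0 ?anorm_ge0.
have good (h t : R) : 0 < t -> t < 2 * h -> besov_quotient Psi r a t <= L ->
    anorm ('Delta_t a) ^+ k.+1 <= C * (2 * h) `^ r.
  move=> t0 th QL.
  apply: le_trans (diff1_pow_le M (Psi t) M1 (PM t) k a) _.
  rewrite mulrA -[leRHS]mulrA; apply: ler_wpM2l.
    by apply: mulr_ge0; apply: exprn_ge0; rewrite ?anorm_ge0.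
  apply: (@le_trans _ _ (L * t `^ r)); last first.
    by rewrite ler_wpM2l// ge0_ler_powR ?nnegrE//; lra.
  rewrite -ler_pdivrMr ?powR_gt0// mulrC -powRN.
  by move: QL; rewrite /besov_quotient gtr0_norm.
have pos (h : R) : 0 < h ->
    anorm ('Delta_h a) ^+ k.+1 <= (2 * M) ^+ k.+1 * (C * (2 * h) `^ r).
  move=> h0; have [t [ht th Qt Qth]] := pairs h h0.
  have b1 := good h t (lt_trans h0 ht) th Qt.
  have th0 : 0 < t - h by lra.
  have b2 := good h (t - h) th0 ltac:(lra) Qth.
  have hle : anorm ('Delta_h a) <=
      M * (anorm ('Delta_t a) + anorm ('Delta_(t - h) a)).
    have -> : 'Delta_h a = Psi (h - t) ('Delta_t a - 'Delta_(t - h) a).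
      rewrite /difference opprB addrA subrK autB !autD subrK addrA subrK.
      by rewrite subrr aut0.
    apply: le_trans (PM _ 1%N _) _.
    by rewrite ler_wpM2l// anormB_le.
  set m := Num.max (anorm ('Delta_t a)) (anorm ('Delta_(t - h) a)).
  have m0 : 0 <= m by rewrite le_max anorm_ge0.
  have mk : m ^+ k.+1 <= C * (2 * h) `^ r.
    by rewrite /m; case: (leP (anorm ('Delta_t a))).
  apply: (@le_trans _ _ ((2 * M) ^+ k.+1 * m ^+ k.+1)); last first.
    by rewrite ler_wpM2l// exprn_ge0// mulr_ge0.
  rewrite -exprMn lerXn2r ?nnegrE ?mulr_ge0 ?anorm_ge0//.
  apply: le_trans hle _; rewrite [2 * M]mulrC -mulrA ler_wpM2l//.
  by rewrite mulr_natl mulr2n lerD// /m le_max lexx ?orbT.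
pose K := M ^+ k.+1 * ((2 * M) ^+ k.+1 * (C * 2 `^ r)).
have K0 : 0 <= K.
  have M2 : 0 <= 2 * M by rewrite mulr_ge0.
  by apply: mulr_ge0; rewrite ?exprn_ge0// mulr_ge0 ?exprn_ge0// mulr_ge0 ?powR_ge0.
(* Negative times reduce to positive ones through
   [psi_h a - a = - psi_h (psi_(-h) a - a)], at the cost of a factor [M]. *)
have hoelder h : anorm ('Delta_h a) ^+ k.+1 <= K * `|h| `^ r.
  have posK (h' : R) : 0 < h' -> M ^+ k.+1 * anorm ('Delta_h' a) ^+ k.+1 <= K * h' `^ r.
    move=> h0; rewrite /K -[leRHS]mulrA; apply: ler_wpM2l; first by rewrite exprn_ge0.
    rewrite -[leRHS]mulrA -[C * _ * _]mulrA -powRM ?(ltW h0)//; exact: pos.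
  have [h0|h0|->] := ltgtP h 0; last first.
  - rewrite /difference aut0 subrr anorm0 expr0n.
    by rewrite mulr_ge0 ?powR_ge0.
  - rewrite gtr0_norm//; apply: le_trans (posK _ h0).
    by rewrite ler_peMl ?exprn_ge0 ?anorm_ge0// exprn_ege1.
  - rewrite ltr0_norm//; apply: le_trans (posK _ _); last by rewrite oppr_gt0.
    rewrite -exprMn lerXn2r ?nnegrE ?mulr_ge0 ?anorm_ge0//.
    have -> : 'Delta_h a = - Psi h ('Delta_(- h) a).
      by rewrite /difference autB autD subrr aut0 opprB.
    by rewrite anormN; exact: (PM h 1%N).
apply/cvgr0Pnorm_lt => e e0.
(* Chosen so that [K d^r < e^(k+1)]; adding [1] avoids dividing by zero. *)
pose d := (e ^+ k.+1 / (K + 1)) `^ r^-1.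
have K1 : 0 < K + 1 by lra.
have d0 : 0 < d by rewrite powR_gt0// divr_gt0// exprn_gt0.
near=> h.
rewrite ger0_norm ?anorm_ge0//.
rewrite -(@ltr_pXn2r _ k.+1) ?nnegrE ?anorm_ge0 ?(ltW e0)//.
apply: le_lt_trans (hoelder h) _.
have hd : `|h| <= d by near: h; exact: (@nbhs0_le _ R).
have hdr : `|h| `^ r <= e ^+ k.+1 / (K + 1).
  have -> : e ^+ k.+1 / (K + 1) = d `^ r.
    by rewrite /d -powRrM mulVf ?gt_eqF// powRr1// divr_ge0 ?exprn_ge0// ltW.
  by apply: ge0_ler_powR => //; rewrite ?nnegrE// ltW.
apply: le_lt_trans (ler_wpM2l K0 hdr) _.
rewrite mulrA ltr_pdivrMr// mulrC ltr_pM2l ?exprn_gt0//; lra.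
Unshelve. all: by end_near. Qed.

End AutomorphismGroup.

(** * Besov seminorms and norm control *)

Lemma geometric_sum_quotient {F : fieldType} (x : F) n :
  (if x - 1 == 0 then n%:R else (x ^+ n - 1) / (x - 1)) = \sum_(m < n) x ^+ m.
Proof.
case: eqVneq => [|x1]; last by rewrite subrX1 mulrC mulKf.
move/eqP; rewrite subr_eq0 => /eqP ->.
under eq_bigr do rewrite expr1n.
by rewrite sumr_const card_ord.
Qed.

Section Seminorm.
Context {R : realType} {s : scalar_kind} {A : banachAlgType R s}.
Variable Psi : automorphism_group A.

Lemma besov_quotient_ge0 r (a : A) t : 0 <= besov_quotient Psi r a t.
Proof. by rewrite mulr_ge0 ?powR_ge0 ?anorm_ge0. Qed.

Lemma besov_seminorm_ge0 p r (a : A) : (1 <= p)%E ->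
  (0 <= besov_seminorm Psi p r a)%E.
Proof.
case: p => [q| |]// p1; first exact: poweR_ge0.
apply: (@le_trans _ _ (besov_quotient Psi r a 1)%:E).
  by rewrite lee_fin besov_quotient_ge0.
by apply: ereal_sup_ubound; exists 1 => //=; rewrite oner_neq0.
Qed.

(** The step from estimates at each single [t] to Besov seminorms: both the
    supremum and the weighted [L^q] norm are monotone and homogeneous. *)
Lemma besov_seminorm_le_scale p r (K : R) (a b : A) : (1 <= p)%E -> 0 <= K ->
  (p != +oo%E -> measurable_fun [set: R] (besov_quotient Psi r a)) ->
  (p != +oo%E -> measurable_fun [set: R] (besov_quotient Psi r b)) ->
  (forall t, besov_quotient Psi r b t <= K * besov_quotient Psi r a t) ->
  (besov_seminorm Psi p r b <= K%:E * besov_seminorm Psi p r a)%E.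
Proof.
case: p => [q| |]// p1 K0 ma mb ba; last first.
  apply: ge_ereal_sup => _ [t t0 <-].
  apply: (@le_trans _ _ (K%:E * (besov_quotient Psi r a t)%:E)%E).
    by rewrite -EFinM lee_fin.
  by apply: lee_wpmul2l; rewrite ?lee_fin//; apply: ereal_sup_ubound; exists t.
rewrite lee_fin in p1; have q0 : 0 < q by lra.
rewrite /besov_seminorm.
have mF c := measurable_powR_div (besov_quotient Psi r c) q.
have F0 c t : (0 <= (besov_quotient Psi r c t `^ q / `|t|)%:E)%E.
  by rewrite lee_fin divr_ge0 ?powR_ge0.
have -> : K%:E = ((K `^ q)%:E `^ q^-1)%E.
  by rewrite poweR_EFin -powRrM divff ?gt_eqF// powRr1.
rewrite -poweRM ?lee_fin ?powR_ge0//; last by apply: integral_ge0 => t _; exact: F0.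
rewrite -ge0_integralZl//; [|exact: mF (ma isT)|by rewrite lee_fin powR_ge0].
apply: gt0_ler_poweR.
- by rewrite invr_ge0 ltW.
- by rewrite in_itv/= leey andbT; apply: integral_ge0 => t _; exact: F0.
- rewrite in_itv/= leey andbT; apply: integral_ge0 => t _.
  by apply: mule_ge0; [rewrite lee_fin powR_ge0|exact: F0].
apply: ge0_le_integral => //.
- exact: mF (mb isT).
- by apply: measurable_funeM; exact: mF (ma isT).
move=> t _; rewrite -EFinM lee_fin mulrA ler_wpM2r//.
rewrite -powRM ?besov_quotient_ge0//.
apply: ge0_ler_powR => //; first exact: ltW.
  by rewrite nnegrE besov_quotient_ge0.
by rewrite nnegrE mulr_ge0 ?besov_quotient_ge0.
Qed.

End Seminorm.

Theorem theorem2p9 (R : realType) (s : scalar_kind)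
    (A : banachAlgType R s) (Psi : automorphism_group A)
    (p : \bar R) (r : R) (hp : (1 <= p)%E) (hr : 0 < r) :
  exists C : R, 0 < C /\
    (forall a : A, besov Psi p r a -> a \is a GRing.unit ->
       let n := (Num.truncn r).+1 in
       let u := anorm a^-1 in
       let v := fine (besov_norm Psi p r a) in
       besov Psi p r a^-1 /\
       (besov_seminorm Psi p r (a^-1)%R <=
          (C * u ^+ 2 * v *
             (if u * v - 1 == 0 then n%:R
              else (u ^+ n * v ^+ n - 1) / (u * v - 1)))%:E)%E) /\
    (forall (a : A) (delta : R),
       besov Psi p r a -> a \is a GRing.unit -> 0 < delta ->
       (besov_norm Psi p r a <= 1)%E -> anorm a^-1 <= 1 / delta ->
       (besov_norm Psi p r (a^-1)%R <= (C * delta ^- (Num.truncn r).+2)%:E)%E).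
Proof.
set n := (Num.truncn r).+1.
have [M M1 PM] := aut_power_bounded Psi.
have [C0 C00 recip] := reciprocal_difference_le A M n M1.
have normP a : besov Psi p r a -> exists v : R,
    [/\ besov_norm Psi p r a = v%:E, anorm a <= v & (besov_seminorm Psi p r a <= v%:E)%E].
  move=> [_ av]; have s0 := besov_seminorm_ge0 Psi p r a hp.
  have fin : besov_norm Psi p r a \is a fin_num.
    by rewrite ge0_fin_numE// adde_ge0// lee_fin anorm_ge0.
  exists (fine (besov_norm Psi p r a)); split.
  - by rewrite fineK.
  - by rewrite -lee_fin fineK// leeDl.
  - by rewrite fineK// leeDr// lee_fin anorm_ge0.
have main a v : besov Psi p r a -> a \is a GRing.unit ->
    anorm a <= v -> (besov_seminorm Psi p r a <= v%:E)%E ->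
    besov Psi p r a^-1 /\
    (besov_seminorm Psi p r (a^-1)%R <=
      (C0 * anorm a^-1 ^+ 2 * v * \sum_(m < n) (anorm a^-1 * v) ^+ m)%:E)%E.
  move=> ba ua av sv.
  have u0 := anorm_ge0 a^-1; set u := anorm a^-1 in u0 *.
  have v0 : 0 <= v := le_trans (anorm_ge0 a) av.
  pose K := C0 * u ^+ 2 * \sum_(m < n) (u * anorm a) ^+ m.
  have K0 : 0 <= K.
    rewrite mulr_ge0 ?mulr_ge0 ?exprn_ge0// sumr_ge0// => m _.
    by rewrite exprn_ge0// mulr_ge0 ?anorm_ge0.
  (* Only finite [p] asks for measurability, and then [a] has a continuous
     orbit, hence so does its inverse. *)
  have mb : p != +oo%E -> measurable_fun [set: R] (besov_quotient Psi r a^-1).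
    move=> poo; apply: measurable_besov_quotient.
    apply: (orbit_continuous_inverse Psi a); rewrite ?mulrV ?mulVr//.
    move: hp poo ba; case: (p) => // q q1 _; exact: besov_orbit_continuous.
  have sb : (besov_seminorm Psi p r (a^-1)%R <=
      (C0 * u ^+ 2 * v * \sum_(m < n) (u * v) ^+ m)%:E)%E.
    apply: le_trans (besov_seminorm_le_scale Psi p r K a a^-1 hp K0 ba.1 mb _) _.
      move=> t; rewrite /besov_quotient mulrCA ler_wpM2l ?powR_ge0//.
      have h : anorm (iter n (difference Psi t) a^-1) <=
          C0 * u ^+ 2 * anorm (iter n (difference Psi t) a) *
            \sum_(m < n) (u * anorm a) ^+ m.
        exact: recip (Psi t) a a^-1 _ (PM t) (mulrV ua) (mulVr ua) (ltnSn _).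
      by apply: le_trans h _; rewrite /K mulrAC.
    apply: (@le_trans _ _ (K%:E * v%:E)%E); first by rewrite lee_wpmul2l ?lee_fin.
    rewrite -EFinM lee_fin /K mulrAC ler_wpM2l ?mulr_ge0 ?exprn_ge0//.
    rewrite ler_sum// => m _; rewrite lerXn2r ?nnegrE ?mulr_ge0 ?anorm_ge0//.
    by rewrite ler_wpM2l.
  split=> //; split=> //.
  by rewrite /besov_norm lte_add_pinfty ?ltry// (le_lt_trans sb) ?ltry.
(* The first estimate holds with [C0]; the second adds [|a^-1| <= w^(n+1)] to [n]
   terms that are each at most [C0 w^(n+1)], where [w = delta^-1 >= 1]. *)
exists (C0 * n%:R + 1); split; first by rewrite ltr_wpDl ?mulr_ge0.
split=> [a ba ua /=|a d ba ua d0 a1 ud].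
  have [v [-> av sv]] := normP a ba; rewrite /fine.
  have [bb sb] := main a v ba ua av sv; split=> //.
  rewrite -exprMn geometric_sum_quotient; apply: le_trans sb _.
  have v0 : 0 <= v := le_trans (anorm_ge0 a) av.
  rewrite lee_fin -!mulrA ler_wpM2r//.
    rewrite !mulr_ge0 ?exprn_ge0 ?anorm_ge0// sumr_ge0// => m _.
    by rewrite exprn_ge0// mulr_ge0 ?anorm_ge0.
  by rewrite ler_wpDr// ler_peMr// ler1n.
have [v [vE av sv]] := normP a ba.
have v1 : v <= 1 by rewrite -lee_fin -vE.
have s1 : (besov_seminorm Psi p r a <= 1%:E)%E.
  by apply: le_trans sv _; rewrite lee_fin.
have [_ sb] := main a 1 ba ua (le_trans av v1) s1.
rewrite div1r in ud; set u := anorm a^-1 in ud sb *.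
have u0 : 0 <= u by exact: anorm_ge0.
rewrite -exprVn; set w := d^-1 in ud *.
have w1 : 1 <= w.
  apply: le_trans (@anorm1_ge1 _ _ A) _; rewrite -(mulrV ua).
  apply: le_trans (anormM_le _ _) _; rewrite -[w]mul1r.
  by apply: ler_pM; rewrite ?anorm_ge0// (le_trans av).
have w0 : 0 <= w := le_trans ler01 w1.
apply: le_trans (leeD2l _ sb) _; rewrite -EFinD lee_fin mulr1 mulrDl mul1r addrC.
apply: lerD; last first.
  by apply: le_trans ud _; rewrite -[leLHS]expr1 ler_weXn2l.
rewrite -[leLHS]mulrA -[leRHS]mulrA ler_wpM2l// mulr_sumr.
apply: (@le_trans _ _ (\sum_(m < n) w ^+ n.+1)); last first.
  by rewrite sumr_const card_ord mulr_natl.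
apply: ler_sum => m _; rewrite mulr1 -exprD.
apply: (@le_trans _ _ (w ^+ (2 + m))); first by rewrite lerXn2r ?nnegrE.
by apply: ler_weXn2l => //; exact: (ltn_ord m).
Qed.
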